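(* For all integers $1\leq k\leq \ell\leq 2k$, and for every $k$-tree $G$ on $n\geq \ell+2$ vertices, the subgraph $G_\ell$ of $G$ induced by the vertices of degree at most $\ell$ in $G$ has treewidth at most $\ell-k$.
   Context: All graphs are finite, undirected, and simple. A $j$-clique is a set of $j$ pairwise adjacent vertices. A vertex is simplicial if its neighbourhood is a clique. The $k$-trees ($k\geq 0$) are defined recursively: a graph $G$ is a $k$-tree if either (a) $G$ is a $(k+1)$-clique, or (b) $G$ has a simplicial vertex $v$ whose neighbourhood is a $k$-clique, and the graph $G\setminus v$ obtained by deleting $v$ is a $k$-tree. The treewidth of a graph $G$ is the minimum integer $k$ such that $G$ is a subgraph of a chordal graph with no clique on more than $k+1$ vertices. *)

(* Defs.v *)
From HB Require Import structures.
From mathcomp Require Import all_boot all_order all_algebra.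
From mathcomp Require Import boolp.
Set Implicit Arguments.
Unset Strict Implicit.
Unset Printing Implicit Defensive.
Import Order.TTheory GRing.Theory Num.Theory.

Record sgraph := SGraph {
  vertex :> finType;
  edge : rel vertex;
  edge_sym : symmetric edge;
  edge_irr : irreflexive edge }.

Section Graph.
Variable G : sgraph.
Implicit Types (x y : G) (C : {set G}).

Definition neighbours x : {set G} := [set y | edge x y].

Definition degree x : nat := #|neighbours x|.

Definition clique C : Prop := {in C &, forall x y, x != y -> edge x y}.

Definition kclique (j : nat) C : Prop := clique C /\ #|C| = j.

Definition simplicial (v : G) : Prop := clique (neighbours v).

(* In a cycle c, the vertices adjacent to x along c are [next c x] and
   [prev c x]; a chord is an edge between two vertices of c that are not
   adjacent along c. *)
Definition chordal : Prop :=
  forall c : seq G, ucycle (@edge G) c -> 4 <= size c ->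
    exists x y, [/\ x \in c, y \in c, edge x y, y != next c x & y != prev c x].

Section Induced.
Variable S : {set G}.

Definition induced_edge : rel {x : G | x \in S} :=
  fun u v => edge (val u) (val v).

Lemma induced_edge_sym : symmetric induced_edge.
Proof. by move=> u v; apply: edge_sym. Qed.

Lemma induced_edge_irr : irreflexive induced_edge.
Proof. by move=> u; apply: edge_irr. Qed.

Definition induced : sgraph := SGraph induced_edge_sym induced_edge_irr.
End Induced.

End Graph.

Inductive ktree (k : nat) : sgraph -> Prop :=
| ktree_clique (G : sgraph) :
    kclique k.+1 [set: G] -> ktree k G
| ktree_add (G : sgraph) (v : G) :
    simplicial v -> kclique k (neighbours v) ->
    ktree k (induced [set~ v]) -> ktree k G.

(* Up to isomorphism: H may have more vertices and more edges than G. *)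
Definition subgraph (G H : sgraph) : Prop :=
  exists2 f : G -> H, injective f & forall x y, edge x y -> edge (f x) (f y).

(* Over int rather than nat: the graph without vertices gets treewidth -1. *)
Definition has_chordal_supergraph (G : sgraph) (w : int) : Prop :=
  exists H : sgraph, [/\ subgraph G H, chordal H
    & forall C : {set H}, clique C -> (#|C|%:Z <= w + 1)%R].

Definition is_treewidth (G : sgraph) (w : int) : Prop :=
  has_chordal_supergraph G w /\
  forall w' : int, has_chordal_supergraph G w' -> (w <= w')%R.

Section Complete.
Variable G : sgraph.

Lemma neq_sym : symmetric (fun x y : G => x != y).
Proof. by move=> x y /=; rewrite eq_sym. Qed.

Lemma neq_irr : irreflexive (fun x y : G => x != y).
Proof. by move=> x /=; rewrite eqxx. Qed.

Definition complete : sgraph := SGraph neq_sym neq_irr.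

Lemma complete_chordal : chordal complete.
Proof.
move=> [|a [|b [|c [|d s]]]] //= /andP[_ /=]; rewrite !inE !negb_or.
move=> /and5P[/and4P[nab nac nad nas] /and3P[nbc _ _] /andP[ncd ncs] _ _] _.
exists a, c; split; rewrite ?inE ?eqxx ?orbT //=; first by rewrite eq_sym.
rewrite (negPf nab) (negPf nac) (negPf nad).
elim: s d nad nas ncd ncs => [|e s IHs] d nad /= nas ncd ncs.
  by rewrite eqxx.
move: nas ncs; rewrite !inE !negb_or => /andP[nae nas] /andP[nce ncs].
by rewrite (negPf nae); apply: IHs.
Qed.

End Complete.

Lemma treewidth_exists (G : sgraph) : exists w : int, is_treewidth G w.
Proof.
pose P (m : nat) := `[< has_chordal_supergraph G (m%:Z - 1)%R >].
have exP : exists m, P m.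
  exists #|G|; apply/asboolP; exists (complete G); split.
  - exists id => // x y xy; apply/eqP => E.
    by move: xy; rewrite E edge_irr.
  - exact: complete_chordal.
  - by move=> C _; rewrite subrK lez_nat; exact: (@max_card (vertex G)).
case: (ex_minnP exP) => m /asboolP Pm minm.
exists (m%:Z - 1)%R; split=> // w' Pw'.
have w'_ge : (0 <= w' + 1)%R.
  case: Pw' => H [_ _ /(_ set0)]; rewrite cards0; apply.
  by move=> x y; rewrite inE.
rewrite lerBlDr -(gez0_abs w'_ge) lez_nat; apply: minm.
by apply/asboolP; rewrite gez0_abs // addrK.
Qed.

Definition treewidth (G : sgraph) : int := sval (cid (treewidth_exists G)).

Lemma treewidthP (G : sgraph) : is_treewidth G (treewidth G).
Proof. exact: (svalP (cid (treewidth_exists G))). Qed.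

Definition low_degree (G : sgraph) (l : nat) : sgraph :=
  induced [set x : G | degree x <= l].

(* Main.v *)
(* Induced subgraphs of the chordal graph G are chordal, so it suffices to bound
   the cliques of G_l. Call a vertex universal if it is adjacent to all others.
   If G is obtained from G' by adding v with a k-clique N(v) as neighbourhood,
   the universal vertices of G' together with N(v) form a clique of G', of size
   at most k + 1, so at most one vertex loses its universality. Hence a clique
   of a k-tree on n vertices contains at most n - k - 1 non-universal vertices.
   By induction along the construction, a clique with more than p vertices in a
   k-tree on more than k + p vertices has a vertex of degree at least k + p;
   take p = l - k + 1. *)
Require Import Defs.
From mathcomp Require Import all_boot all_order all_algebra.
From mathcomp Require Import zify.
Set Implicit Arguments.
Unset Strict Implicit.
Unset Printing Implicit Defensive.

(** * Cliques and cycles in induced subgraphs *)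

Section Induced.
Variables (G : sgraph) (S : {set G}).

Definition trace (C : {set G}) : {set induced S} := [set u | val u \in C].

Lemma card_trace (C : {set G}) : #|trace C| = #|C :&: S|.
Proof.
rewrite -(card_imset (mem (trace C)) val_inj); apply: eq_card => x.
rewrite !inE; apply/imsetP/andP => [[u]|[xC xS]].
  by rewrite !inE => uC ->; split=> //; exact: (valP u).
by exists (Sub x xS); rewrite ?inE.
Qed.

Lemma clique_trace (C : {set G}) : clique C -> clique (trace C).
Proof.
by move=> clC u w; rewrite !inE => uC wC uw; apply: clC.
Qed.

Lemma clique_imset_val (C : {set induced S}) :
  clique C -> clique [set val u | u in C].
Proof.
move=> clC _ _ /imsetP[u uC ->] /imsetP[w wC ->] uw.
by apply: (clC u w) => //; apply: contraNneq uw => ->.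
Qed.

Lemma chordal_induced : chordal G -> chordal (induced S).
Proof.
move=> chG c /andP[cyc unc] szc.
have ucv : ucycle (@edge G) [seq val u | u <- c].
  rewrite /ucycle map_inj_uniq ?unc ?andbT; last exact: val_inj.
  by rewrite cycle_map.
have [|x [y [/mapP[u uc ->] /mapP[w wc ->] uw]]] := chG _ ucv.
  by rewrite size_map.
rewrite (next_map val_inj unc) (prev_map val_inj unc).
by rewrite !(inj_eq val_inj) => wn wp; exists u, w.
Qed.

Lemma map_val_induced (c : seq G) :
  {subset c <= S} -> exists c' : seq (induced S), c = map val c'.
Proof.
elim: c => [|x c IHc] cS; first by exists [::].
have [|c' ->] := IHc; first by move=> y yc; apply: cS; rewrite inE yc orbT.
have xS : x \in S by apply: cS; rewrite inE eqxx.
by exists ((Sub x xS : {x | x \in S}) :: c').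
Qed.

End Induced.

(** * Simplicial vertices, chordality and universal vertices *)

Section Graph.
Variable G : sgraph.
Implicit Types (x y v : G) (C : {set G}).

Lemma clique_sub_neighbours C v :
  clique C -> v \in C -> C :\ v \subset neighbours v.
Proof.
move=> clC vC; apply/subsetP => x; rewrite !inE => /andP[xv xC].
by apply: clC => //; rewrite eq_sym.
Qed.

(** The two vertices next to [v] along the cycle are neighbours of [v], hence adjacent to each
    other; length at least 4 makes this edge a chord. *)
Lemma simplicial_chord (c : seq G) v :
  simplicial v -> v \in c -> ucycle (@edge G) c -> 4 <= size c ->
  exists x y, [/\ x \in c, y \in c, edge x y, y != next c x & y != prev c x].
Proof.
move=> simv /rot_to[i c' def_c] /andP[cyc unc] szc.
have [unc' cyc'] : uniq (v :: c') /\ cycle (@edge G) (v :: c').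
  by rewrite -def_c rot_uniq rot_cycle.
have nextE := next_rot i unc; have prevE := prev_rot i unc.
have memE := mem_rot i c.
have szc' : 4 <= size (v :: c') by rewrite -def_c size_rot.
rewrite def_c in nextE prevE memE.
case: c' {def_c} szc' unc' cyc' nextE prevE memE => [|a c'] //.
(* The rotated cycle reads [v], [a], [d], ..., [b]. The chord joins [a] to [b], since [a] has
   successor [d] and predecessor [v], both distinct from [b]. *)
case/lastP: c' => [|c' b] //; case: c' => [|d c'] //= _ unc' cyc' nextE prevE memE.
move: unc' cyc'; rewrite !inE !negb_or !mem_rcons !inE !negb_or rcons_uniq.
move=> /andP[/and4P[va vd vb vc']] /andP[/and3P[ad ab ac']].
move=> /andP[/andP[db dc'] /andP[bc' unc']] /and3P[eva ead].
rewrite !rcons_path last_rcons => /andP[_ ebv].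
exists a, b; split.
- by rewrite -memE !inE eqxx orbT.
- by rewrite -memE !inE mem_rcons inE eqxx !orbT.
- by apply: simv => //; rewrite inE // edge_sym.
- rewrite -nextE /= (eq_sym a v) (negPf va) eqxx.
  by rewrite eq_sym.
- by rewrite -prevE /= eqxx eq_sym.
Qed.

(** A cycle through [v] falls under [simplicial_chord]; a cycle avoiding [v] lives in the induced
    subgraph, where it already has a chord. *)
Lemma chordal_add_simplicial v :
  simplicial v -> chordal (induced [set~ v]) -> chordal G.
Proof.
move=> simv chG' c ucc szc.
have [vc | vNc] := boolP (v \in c); first exact: (simplicial_chord simv vc).
have [|c' def_c] := @map_val_induced G [set~ v] c.
  by move=> x xc; rewrite !inE; apply: contraNneq vNc => <-.
move: ucc szc; rewrite {}def_c size_map => /andP[cyc unc] szc {vNc}.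
have uc' : uniq c' by move: unc; rewrite map_inj_uniq //; exact: val_inj.
have [|x [y [xc yc xy yn yp]]] := chG' c' _ szc.
  by rewrite /ucycle uc' andbT; rewrite cycle_map in cyc.
exists (val x), (val y); split; rewrite ?(mem_map val_inj) //.
  by rewrite (next_map val_inj uc') (inj_eq val_inj).
by rewrite (prev_map val_inj uc') (inj_eq val_inj).
Qed.

Definition universal : {set G} := [set x | [forall y, (y != x) ==> edge x y]].

Lemma universalP x : reflect (forall y, y != x -> edge x y) (x \in universal).
Proof.
rewrite inE; apply: (iffP forallP) => ux y; last exact/implyP/ux.
by move/(_ y)/implyP: ux.
Qed.

Lemma clique_setU_universal C : clique C -> clique (C :|: universal).
Proof.
move=> clC x y; rewrite !in_setU => xCU yCU xy.
have [/universalP|xNU] := boolP (x \in universal).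
  by apply; rewrite eq_sym.
have [/universalP uy|yNU] := boolP (y \in universal).
  by rewrite edge_sym; apply: uy.
by move: xCU yCU; rewrite (negPf xNU) (negPf yNU) !orbF => xC yC; apply: clC.
Qed.

Lemma degree_universal x : x \in universal -> (degree x).+1 = #|G|.
Proof.
move/universalP=> ux; rewrite (cardD1 x) inE add1n; congr _.+1.
apply: eq_card => y; rewrite !inE andbT.
by apply/idP/idP=> [|/ux //]; apply: contraTneq => ->; rewrite edge_irr.
Qed.

Lemma card_induced_setC1 v : #|induced [set~ v]|.+1 = #|G|.
Proof.
have -> : #|induced [set~ v]| = #|[set~ v]| by rewrite card_sig; apply: eq_card.
have := cardsC [set v]; rewrite cards1 => <-.
by rewrite add1n.
Qed.

Lemma card_trace_setC1 C v : #|trace [set~ v] C| = #|C :\ v|.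
Proof. by rewrite card_trace setDE. Qed.

Lemma degree_induced_setC1 v (x : induced [set~ v]) :
  degree (val x) = edge (val x) v + degree x.
Proof.
have -> : degree x = #|neighbours (val x) :\ v|.
  rewrite -card_trace_setC1; apply: eq_card => y; by rewrite !inE.
by rewrite /degree (cardsD1 v) inE.
Qed.

End Graph.

Lemma universal_add (G : sgraph) (v : G) (x : induced [set~ v]) :
  edge v (val x) -> x \in universal (induced [set~ v]) ->
  val x \in universal G.
Proof.
move=> vx /universalP ux; apply/universalP => y yx.
have [->|yv] := eqVneq y v; first by rewrite edge_sym.
have yS : y \in [set~ v] by rewrite !inE.
exact: (ux (Sub y yS : {y | y \in [set~ v]})).
Qed.

(** * Cliques and degrees in k-trees *)

Lemma ktree_chordal k G : ktree k G -> chordal G.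
Proof.
elim=> {G} [G [clG _]|G v simv _ _ chG']; last exact: chordal_add_simplicial chG'.
move=> [|v c] // ucc szc; apply: (simplicial_chord (v := v)) => //.
  by move=> x y _ _; apply: clG; rewrite inE.
by rewrite inE eqxx.
Qed.

(** A clique containing the added vertex [v] consists of [v] and some of its [k] neighbours; any
    other clique lies in the smaller k-tree. *)
Lemma ktree_card_clique k G : ktree k G ->
  forall C : {set G}, clique C -> #|C| <= k.+1.
Proof.
elim=> {G} [G [_ <-]|G v simv [_ cardN] _ IHG'] C clC.
  by rewrite subset_leq_card ?subsetT.
rewrite (cardsD1 v); have [vC | vNC] := boolP (v \in C).
  by rewrite add1n ltnS -cardN subset_leq_card ?clique_sub_neighbours.
by rewrite add0n -card_trace_setC1; apply/IHG'/clique_trace.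
Qed.

Lemma ktree_card_nonuniversal k G : ktree k G ->
  forall C : {set G}, clique C -> #|C :\: universal G| + k.+1 <= #|G|.
Proof.
elim=> {G} [G [clG cardG]|G v simv [_ cardN] tG' IHG'] C clC.
  rewrite (_ : C :\: _ = set0) ?cards0 -?cardG ?max_card //.
  apply/eqP; rewrite setD_eq0; apply/subsetP=> x _; apply/universalP=> y yx.
  by apply: clG; rewrite ?inE // eq_sym.
set S := [set~ v]; set N := trace S (neighbours v).
have clN : clique N by apply: clique_trace.
have cardNS : #|N| = k.
  by rewrite card_trace_setC1 -cardN (cardsD1 v (neighbours v)) inE edge_irr.
have bound := IHG' _ (clique_trace (S := S) clC).
have lossU : #|universal (induced S) :\: N| <= 1.
  have := ktree_card_clique tG' (clique_setU_universal clN).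
  by rewrite -(cardsID N (N :|: _)) setUK setDUl setDv set0U
    cardNS -addn1 leq_add2l.
(* A vertex that is universal before [v] is added stays so if it is adjacent to [v]. *)
have subU : trace S (C :\: universal G) \subset
    (trace S C :\: universal (induced S)) :|:
      ((universal (induced S) :\: N) :&: trace S C).
  apply/subsetP => x; rewrite 2!inE => /andP[xNU xC].
  have xSC : x \in trace S C by rewrite inE.
  rewrite in_setU in_setI !in_setD xSC !andbT.
  case: (boolP (x \in universal (induced S))) => //= xU; rewrite andbT.
  rewrite /N !inE; apply: contra xNU => vx.
  by have := universal_add vx xU.
have := subset_leq_card subU; rewrite card_trace_setC1 -(card_induced_setC1 v).
rewrite (cardsD1 v (C :\: _)).
have [vC | vNC] := boolP (v \in C).
  (* Every other vertex of [C] is adjacent to [v], so none loses universality: only [v] itself can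
     raise the count. *)
  rewrite (_ : _ :&: _ = set0) ?setU0.
    by move: bound; case: (v \in _) => /=; rewrite -/S; lia.
  apply/eqP; rewrite -subset0; apply/subsetP=> x; rewrite in_setI in_setD.
  move=> /andP[/andP[xNN _]]; rewrite inE => xC; case/negP: xNN.
  rewrite inE; apply: (subsetP (clique_sub_neighbours clC vC)).
  by rewrite in_setD1 xC andbT; have := valP x; rewrite !inE.
(* Here the count rises by at most the single loss [lossU], which the extra vertex of [G] pays
   for. *)
rewrite in_setD (negPf vNC) andbF add0n => le_card.
have le1 := leq_trans (subset_leq_card (subsetIl _ (trace S C))) lossU.
have le_bound := leq_trans le_card
  (leq_trans (leq_card_setU _ _) (leq_add (leqnn _) le1)).
by apply: leq_trans (leq_add le_bound (leqnn _)) _; rewrite addn1 addSn ltnS.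
Qed.

Lemma ktree_clique_degree k G : ktree k G ->
  forall p (C : {set G}), clique C -> p < #|C| -> k + p < #|G| ->
  exists2 x, x \in C & k + p <= degree x.
Proof.
(* The extremal order [k + p + 1]: at most [p] vertices of [C] are non-universal, so some vertex of
   [C] has degree [k + p]. *)
have universal_case (H : sgraph) p (C : {set H}) : ktree k H -> clique C -> p < #|C| ->
    k + p.+1 = #|H| -> exists2 x, x \in C & k + p <= degree x.
  move=> tH clC pC cardH.
  have [x|CNU] := pickP [pred x in C | x \in universal H].
    move=> /andP[xC /degree_universal dx]; exists x => //.
    by rewrite -ltnS dx -cardH addnS.
  have := ktree_card_nonuniversal tH clC.
  rewrite (_ : C :\: _ = C); first by lia.
  apply/setDidPl; rewrite disjoint_subset; apply/subsetP=> x xC.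
  by apply/negP=> /= xU; have := CNU x; rewrite /= xC xU.
elim=> {G} [G clG|G v simv clN tG' IHG'] p C clC pC.
  have := max_card (mem C); case: (clG) => _; rewrite cardsT => cardG leC ltG.
  (* With only [k + 1] vertices, [p] must be 0 and the order is extremal. *)
  have [cardE|ltG'] := eqVneq (k + p.+1) #|G|; last by lia.
  by apply: universal_case => //; exact: ktree_clique.
have tG := ktree_add simv clN tG'.
have [cardE _|neG ltG] := eqVneq (k + p.+1) #|G|; first exact: universal_case.
have cG := card_induced_setC1 v.
(* The term [edge x v] records the degree that [x] gains when [v] is put back. *)
have lift q : q < #|C :\ v| -> k + q < #|induced [set~ v]| ->
    exists2 x, x \in C :\ v & edge x v + (k + q) <= degree x.
  rewrite -card_trace_setC1 => qC qG.
  have [x xC dx] := IHG' q _ (clique_trace clC) qC qG.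
  exists (val x).
    by have := valP x; rewrite in_setD1 !inE => ->; rewrite inE in xC.
  by rewrite degree_induced_setC1 leq_add2l.
have [vC | vNC] := boolP (v \in C); last first.
  have [||x /setD1P[_ xC] dx] := lift p.
  - by rewrite (cardsD1 v) (negPf vNC) in pC.
  - by lia.
  by exists x => //; apply: leq_trans dx; exact: leq_addl.
(* If [v] is in [C], then for [p = 0] the vertex [v], of degree [k], suffices. Otherwise removing
   [v] from [C] costs one unit of [p], and adjacency to [v] restores it. *)
case: p pC ltG {neG} => [|p] pC ltG.
  by exists v => //; rewrite addn0 /degree (proj2 clN).
rewrite (cardsD1 v) vC ltnS in pC.
have [||x /setD1P[xv xC] dx] := lift p => //; first by lia.
exists x => //; apply: leq_trans dx.
by rewrite (clC x v) // addnS.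
Qed.

Theorem theorem4 (k l : nat) (k_ge1 : 1 <= k) (k_le_l : k <= l)
    (l_le_2k : l <= 2 * k) (G : sgraph) (G_ktree : ktree k G)
    (G_order : l + 2 <= #|G|) :
  (treewidth (low_degree G l) <= l%:Z - k%:Z)%R.
Proof.
have [_] := treewidthP (low_degree G l); apply.
(* The graph is its own chordal supergraph. *)
exists (low_degree G l); split.
- by exists id.
- exact/chordal_induced/(ktree_chordal G_ktree).
move=> C clC; suff: #|C| <= (l - k).+1 by lia.
rewrite leqNgt; apply/negP; rewrite -(card_imset (mem C) val_inj) => ltC.
(* With [p = l - k + 1], an oversized clique would contain a vertex of degree at least [l + 1];
   [G_order] gives [k + p < #|G|]. *)
have [|x /imsetP[u _ ->]] :=
  ktree_clique_degree G_ktree (clique_imset_val clC) ltC; first by lia.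
by have := valP u; rewrite inE; lia.
Qed.
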